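(* Let $d_1,\ldots,d_r$ be positive integers and let $\Xi(d_1,d_2,\ldots,d_r)=P_{d_1}\,\square\, P_{d_2}\,\square\,\cdots\,\square\, P_{d_r}$ be the $r$-dimensional grid. If $d_1\geq \big((d_2-1)+(d_3-1)+\cdots+(d_r-1)\big)\,(d_2d_3\cdots d_r)$, then ${\rm ip}_{p}(\Xi(d_1,\ldots,d_r))={\rm ip}_{c}(\Xi(d_1,\ldots,d_r))=d_2d_3\cdots d_r$.
   Context: $P_d$ is the path on $d$ vertices and $\square$ the Cartesian product. A path is isometric if its length equals the distance between its endpoints; single vertices count as paths. ${\rm ip}_{c}(H)$ (resp. ${\rm ip}_{p}(H)$) is the minimum number of isometric paths of $H$ whose vertex sets cover (resp. partition) $V(H)$. *)

(* Defs.v *)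
From mathcomp Require Import all_boot.

Set Implicit Arguments.
Unset Strict Implicit.
Unset Printing Implicit Defensive.

(** A finite graph is given by its adjacency relation
    [e : rel T] on a [finType] of vertices. *)

Section IsometricPaths.

Variables (T : finType) (e : rel T).

Definition walk_of_length (x y : T) (k : nat) : bool :=
  [exists p : k.-tuple T, path e x p && (last x p == y)].

(* Connected vertices are at distance less than [#|T|], so the search range
   suffices; [dist x y] is [#|T|] exactly when no walk joins [x] to [y]. *)
Definition dist (x y : T) : nat := find (walk_of_length x y) (iota 0 #|T|).

(* The path is given by its sequence of vertices, so its length is the size
   of the tail; [::] is not a path. *)
Definition isometric_path (s : seq T) : bool :=
  if s is x :: p then
    [&& path e x p, uniq (x :: p) & size p == dist x (last x p)]
  else false.

(* The vertices of a path are distinct, so sequences of size at most [#|T|]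
   represent all paths of the graph. *)
Definition isometric_path_cover (P : {set #|T|.-bseq T}) : bool :=
  [forall s in P, isometric_path s] && [forall x, exists s in P, x \in s].

Definition isometric_path_partition (P : {set #|T|.-bseq T}) : bool :=
  isometric_path_cover P &&
  [forall s in P, forall t in P, (s != t) ==> [disjoint s & t]].

Lemma ex_isometric_path_partition :
  exists n, [exists P, isometric_path_partition P && (#|P| == n)].
Proof.
have szP (x : T) : size [:: x] <= #|T| by apply/card_gt0P; exists x.
pose f x : #|T|.-bseq T := Bseq (szP x).
pose P := [set f x | x in T].
exists #|P|; apply/existsP; exists P; rewrite eqxx andbT.
apply/andP; split; first (apply/andP; split).
- apply/forall_inP => _ /imsetP[x _ ->] /=.
  have: 0 < #|T| by exact: szP x.
  rewrite /dist; case: #|T| => //= n _.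
  case: ifPn => //= /existsPn /(_ [tuple]); by rewrite /= eqxx.
- apply/forallP => x; apply/exists_inP; exists (f x); first exact: imset_f.
  by rewrite inE.
apply/forall_inP => _ /imsetP[x _ ->]; apply/forall_inP => _ /imsetP[y _ ->].
apply/implyP => fxy; apply/pred0P => z /=; rewrite !inE.
by apply/negP => /andP[/eqP -> /eqP xy]; rewrite xy eqxx in fxy.
Qed.

Lemma ex_isometric_path_cover :
  exists n, [exists P, isometric_path_cover P && (#|P| == n)].
Proof.
have [n /existsP[P /andP[/andP[cP _] nP]]] := ex_isometric_path_partition.
by exists n; apply/existsP; exists P; rewrite cP.
Qed.

Definition ip_c : nat := ex_minn ex_isometric_path_cover.

Definition ip_p : nat := ex_minn ex_isometric_path_partition.

End IsometricPaths.

Definition path_graph (n : nat) : rel 'I_n :=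
  [rel i j : 'I_n | (i.+1 == j :> nat) || (j.+1 == i :> nat)].

Arguments path_graph : clear implicits.

Definition cartesian_product (I : finType) (T : I -> finType)
    (e : forall i, rel (T i)) : rel {dffun forall i, T i} :=
  [rel x y : {dffun forall i, T i} |
    [exists i, e i (x i) (y i) && [forall j, (j != i) ==> (x j == y j)]]].

Definition grid (r : nat) (d : 'I_r -> nat) :
    rel {dffun forall i : 'I_r, 'I_(d i)} :=
  cartesian_product (fun i => path_graph (d i)).

Arguments grid {r} d.

(* Main.v *)
(** In a grid any two vertices are joined by a walk of length at most
    [sum_i (d_i - 1)], so with [S = (d_2 - 1) + ... + (d_r - 1)] and
    [N = d_2 ... d_r] an isometric path has at most [d_1 + S] vertices.  A cover
    by [k] of them satisfies [d_1 N <= k (d_1 + S)]; together with [S N <= d_1]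
    and [0 < d_1] this rules out [k < N].  Conversely the [N] lines parallel to
    the first axis are isometric paths that partition the grid. *)
Require Import Defs.
From mathcomp Require Import all_boot zify.

Set Implicit Arguments.
Unset Strict Implicit.
Unset Printing Implicit Defensive.

(** * Distances, and counting with isometric paths, in an arbitrary finite graph *)

Section Distance.

Variables (T : finType) (e : rel T).
Implicit Types (x y : T) (p : seq T).

Lemma walk_of_lengthP x y k :
  reflect (exists p, [/\ path e x p, last x p = y & size p = k])
          (walk_of_length e x y k).
Proof.
apply: (iffP existsP) => [[p /andP[ep /eqP lp]]|[p [ep lp /eqP sp]]].
  by exists p; rewrite size_tuple.
by exists (Tuple sp); rewrite /= ep lp eqxx.
Qed.

Lemma dist_le x p : path e x p -> dist e x (last x p) <= size p.
Proof.
move=> ep; rewrite /dist.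
have [lt_pT|le_Tp] := ltnP (size p) #|T|; last first.
  (* A walk this long is no shorter than [#|T|], the largest value that [dist] can take. *)
  by apply: leq_trans le_Tp; rewrite -[leqRHS](size_iota 0) find_size.
rewrite leqNgt; apply/negP => /(before_find 0).
rewrite nth_iota // => /walk_of_lengthP; apply; by exists p.
Qed.

(** The bound [k <= #|T|] covers vertices joined by no walk: the second hypothesis is then vacuous
    and [dist] has its default value [#|T|]. *)
Lemma le_dist x y k : k <= #|T| ->
  (forall p, path e x p -> last x p = y -> k <= size p) -> k <= dist e x y.
Proof.
move=> le_kT min_k; rewrite /dist leqNgt; apply/negP => lt_k.
have lt_T := leq_trans lt_k le_kT.
have: has (walk_of_length e x y) (iota 0 #|T|) by rewrite has_find size_iota.
move=> /(nth_find 0); rewrite nth_iota // => /walk_of_lengthP[p [ep lp sp]].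
by have := min_k p ep lp; rewrite sp leqNgt lt_k.
Qed.

Lemma shortest_isometric_path x p : path e x p -> uniq (x :: p) ->
    (forall q, path e x q -> last x q = last x p -> size p <= size q) ->
  isometric_path e (x :: p).
Proof.
move=> ep up min_p; apply/and3P; split=> //; rewrite eqn_leq dist_le // andbT.
apply: le_dist => //; apply: ltnW.
(* Distinct vertices give [size p < #|T|], so the length lies in the search range of [dist]. *)
by have := max_card (mem (x :: p)); rewrite (card_uniqP up).
Qed.

Lemma isometric_path_size m s :
    (forall x y, exists p, [/\ path e x p, last x p = y & size p <= m]) ->
  isometric_path e s -> size s <= m.+1.
Proof.
move=> diam_m; case: s => //= x p /and3P[_ _ /eqP ->].
have [q [eq <- le_qm]] := diam_m x (last x p).
by apply: leq_trans le_qm; apply: dist_le.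
Qed.

(** Double counting of the pairs [(x, s)] with [x \in s]: each path of [P] contributes at most [m],
    each vertex at least 1. *)
Lemma isometric_path_cover_card m (P : {set #|T|.-bseq T}) :
    (forall s, isometric_path e s -> size s <= m) ->
  isometric_path_cover e P -> #|T| <= #|P| * m.
Proof.
move=> le_m /andP[/forall_inP isoP /forallP covP].
rewrite -[leqLHS]sum1_card -sum_nat_const.
have le_sum s : s \in P -> \sum_(x : T) (x \in s : nat) <= m.
  move=> /isoP/le_m; apply: leq_trans.
  by have := card_size s; rewrite -[leqLHS]sum1_card big_mkcond.
apply: leq_trans (leq_sum _ le_sum); rewrite exchange_big /=.
apply: leq_sum => x _; have /exists_inP[s sP xs] := covP x.
by rewrite (bigD1 s) //= xs.
Qed.

Lemma ip_c_le P : isometric_path_cover e P -> ip_c e <= #|P|.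
Proof.
rewrite /ip_c => cP; case: ex_minnP => n _; apply.
by apply/existsP; exists P; rewrite cP eqxx.
Qed.

Lemma ip_p_le P : isometric_path_partition e P -> ip_p e <= #|P|.
Proof.
rewrite /ip_p => cP; case: ex_minnP => n _; apply.
by apply/existsP; exists P; rewrite cP eqxx.
Qed.

Lemma ip_c_attained : exists2 P, isometric_path_cover e P & #|P| = ip_c e.
Proof.
by rewrite /ip_c; case: ex_minnP => n /existsP[P /andP[cP /eqP <-]] _; exists P.
Qed.

Lemma ip_c_le_ip_p : ip_c e <= ip_p e.
Proof.
rewrite [ip_p e]/ip_p; case: ex_minnP => n /existsP[P /andP[/andP[cP _] /eqP <-]] _.
exact: ip_c_le.
Qed.

End Distance.

Lemma path_succ_last m (t : 'I_m) q :
  path [rel i j : 'I_m | j == i.+1 :> nat] t q -> last t q = t + size q :> nat.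
Proof.
elim: q t => [|u q IHq] t /=; first by rewrite addn0.
by move=> /andP[/eqP def_u /IHq ->]; rewrite def_u addSnnS.
Qed.

Lemma sorted_succ_enum_ord m :
  sorted [rel i j : 'I_m | j == i.+1 :> nat] (enum 'I_m).
Proof.
have := sorted_map (f := val) (e' := [rel i j | j == i.+1]) (enum 'I_m).
move=> /= <-; rewrite val_enum_ord; apply/(sortedP 0) => i.
by rewrite size_iota => lt_im; rewrite !nth_iota //= ltnW.
Qed.

Lemma card_dffun_ord n (F : 'I_n -> finType) :
  #|{dffun forall i, F i}| = \prod_(i < n) #|F i|.
Proof. by rewrite card_dep_ffun foldrE big_image. Qed.

(** * Coordinates, walks and axis-parallel lines in the grid *)

Section Grid.

Variables (r : nat) (d : 'I_r -> nat).
Local Notation V := {dffun forall i : 'I_r, 'I_(d i)}.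
Implicit Types x y z : V.

Definition set_coord x i (t : 'I_(d i)) : V := [ffun j => dfwith x t j].

Lemma set_coord_in x i (t : 'I_(d i)) : set_coord x t i = t.
Proof. by rewrite ffunE dfwith_in. Qed.

Lemma set_coord_out x i (t : 'I_(d i)) j : j != i -> set_coord x t j = x j.
Proof. by move=> ji; rewrite ffunE dfwith_out // eq_sym. Qed.

Lemma set_coordK x i (t : 'I_(d i)) : set_coord (set_coord x t) (x i) = x.
Proof.
apply/ffunP => j; have [->|ji] := eqVneq j i; first by rewrite set_coord_in.
by rewrite !set_coord_out.
Qed.

Lemma grid_edge_set_coord x y i :
  path_graph (d i) (x i) (y i) -> (forall j, j != i -> x j = y j) -> grid d x y.
Proof.
move=> e_i eq_xy; apply/existsP; exists i; rewrite e_i /=.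
by apply/forall_inP => j /eq_xy/eqP.
Qed.

(** The one-sided bound suffices below, since lines are traversed in increasing order of their
    coordinate. *)
Lemma grid_edge_coord x y i : grid d x y -> y i <= (x i).+1.
Proof.
case/existsP => j /andP[e_j /forall_inP eq_xy].
have [->|/eq_xy/eqP->//] := eqVneq i j.
by move: e_j => /= /orP[] /eqP; lia.
Qed.

Lemma grid_path_coord x p i : path (grid d) x p -> last x p i <= x i + size p.
Proof.
elim: p x => [|y p IHp] x /=; first by rewrite addn0.
by move=> /andP[/(@grid_edge_coord _ _ i) xy /IHp]; lia.
Qed.

(** The size is the l1 distance: with truncated subtraction, the two differences add up to the
    absolute value. Induction on this distance moves one differing coordinate a unit step towards
    [y]. *)
Lemma grid_walk x y : exists p,
  [/\ path (grid d) x p, last x p = y &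
      size p = \sum_i ((x i - y i) + (y i - x i))].
Proof.
have [n] := ubnP (\sum_i ((x i - y i) + (y i - x i))).
elim: n x => // n IHn x lt_n.
have [->|/eqP ne_xy] := eqVneq x y.
  by exists [::]; split=> //=; rewrite big1 // => i _; rewrite subnn.
have [i ne_i] : exists i, x i != y i.
  apply/existsP; apply: contraT => /existsPn eq_xy; case: ne_xy.
  by apply/ffunP => i; apply/eqP; rewrite -[_ == _]negbK eq_xy.
have {}ne_i : x i <> y i :> nat by apply/eqP.
(* The new coordinate lies between [x i] and [y i], hence stays in range. *)
have lt_t : (if x i < y i then (x i).+1 else (x i).-1) < d i.
  by have := ltn_ord (x i); have := ltn_ord (y i); case: ifP; lia.
pose t := Ordinal lt_t; pose x' := set_coord x t.
have xx' : grid d x x'.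
  apply: (@grid_edge_set_coord _ _ i) => [|j ji]; last by rewrite set_coord_out.
  by rewrite set_coord_in /path_graph /= /t /=; case: ifP; lia.
have sum_x' : \sum_i ((x i - y i) + (y i - x i)) =
              (\sum_i ((x' i - y i) + (y i - x' i))).+1.
  rewrite (bigD1 i) //= [in RHS](bigD1 i) //= set_coord_in.
  under [in RHS]eq_bigr => j ji do rewrite set_coord_out //.
  by rewrite /t /=; case: ifP; lia.
have [|p [ep lp sp]] := IHn x'; first by rewrite sum_x' in lt_n; lia.
by exists (x' :: p); split; rewrite ?sum_x' -?sp /= ?xx'.
Qed.

Lemma grid_isometric_path_size s :
  isometric_path (grid d) s -> size s <= (\sum_i (d i - 1)).+1.
Proof.
apply: isometric_path_size => x y; have [p [ep lp sp]] := grid_walk x y.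
exists p; split=> //; rewrite sp; apply: leq_sum => i _.
by case: (x i) (y i) => [a lt_a] [b lt_b] /=; lia.
Qed.

Definition line i x : seq V := [seq set_coord x t | t <- enum 'I_(d i)].

Lemma line_uniq i x : uniq (line i x).
Proof.
rewrite map_inj_uniq ?enum_uniq // => t u /ffunP/(_ i).
by rewrite !set_coord_in.
Qed.

(** Coordinate [i] grows by exactly 1 at each step of the line and by at most 1 along any edge, so
    no walk with the same ends is shorter. *)
Lemma line_isometric i x : isometric_path (grid d) (line i x).
Proof.
have := line_uniq i x; have := sorted_succ_enum_ord (d i); rewrite /line.
case def_s: (enum 'I_(d i)) => [|t q] /=.
  (* The line is not empty, because [x i] inhabits ['I_(d i)]. *)
  by have := mem_enum 'I_(d i) (x i); rewrite def_s.
move=> tq Uq; apply: shortest_isometric_path => //.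
  rewrite path_map; apply: sub_path tq => u v /= /eqP def_v.
  apply: (@grid_edge_set_coord _ _ i) => [|j ji]; last by rewrite !set_coord_out.
  by rewrite !set_coord_in /path_graph /= def_v eqxx.
move=> p /(@grid_path_coord _ _ i) le_p lp.
rewrite lp last_map !set_coord_in (path_succ_last tq) in le_p.
by rewrite size_map -(leq_add2l t).
Qed.

Lemma line_size_le i x : size (line i x) <= #|V|.
Proof. by rewrite -(card_uniqP (line_uniq i x)) max_card. Qed.

End Grid.

(** * The partition into lines, and the comparison of both bounds *)

Lemma card_grid_hyperplane r (d : 'I_r.+1 -> nat) : 0 < d ord0 ->
  #|[set x : {dffun forall i, 'I_(d i)} | x ord0 == 0 :> nat]| =
    \prod_(i < r) d (lift ord0 i).
Proof.
(* The hyperplane is a product of coordinate sets: a singleton on the first axis, everything on the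
   others. *)
move=> d0; pose F i : pred 'I_(d i) := fun t => (i == ord0) ==> (t == 0 :> nat).
have -> : #|[set x : {dffun forall i, 'I_(d i)} | x ord0 == 0 :> nat]| =
          #|(family F : simpl_pred {dffun forall i, 'I_(d i)})|.
  apply: eq_card => x; rewrite inE; apply/idP/familyP => [x0 i|/(_ ord0)//].
  by apply/implyP => /eqP->.
rewrite card_family foldrE big_image big_ord_recl.
have -> : #|F ord0| = 1.
  rewrite -(card1 (Ordinal d0)); apply: eq_card => t; by rewrite !inE -val_eqE.
rewrite [LHS]mul1n; apply: eq_bigr => i _; rewrite -[RHS]card_ord.
by apply: eq_card => t; rewrite inE.
Qed.

(** The lines parallel to the first axis are indexed by their feet in the hyperplane where the first
    coordinate is 0. *)
Lemma ip_p_grid_le r (d : 'I_r.+1 -> nat) : 0 < d ord0 ->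
  ip_p (grid d) <= \prod_(i < r) d (lift ord0 i).
Proof.
move=> d0; pose V := {dffun forall i : 'I_r.+1, 'I_(d i)}.
pose L (x : V) : #|V|.-bseq V := Bseq (line_size_le ord0 x).
pose H := [set x : V | x ord0 == 0 :> nat].
rewrite -card_grid_hyperplane //; apply: leq_trans (leq_imset_card L H).
apply: ip_p_le; apply/andP; split; first (apply/andP; split).
- by apply/forall_inP => _ /imsetP[x _ ->]; apply: line_isometric.
- apply/forallP => x; apply/exists_inP; exists (L (set_coord x (Ordinal d0))).
    by apply: imset_f; rewrite inE set_coord_in.
  by apply/mapP; exists (x ord0); rewrite ?mem_enum // set_coordK.
apply/forall_inP => _ /imsetP[x Hx ->]; apply/forall_inP => _ /imsetP[y Hy ->].
(* If two lines share a vertex [z], their feet agree with [z] off the first axis and are both 0 on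
   it, so they coincide. *)
apply/implyP; apply: contraR => /pred0Pn[z /andP[/mapP[t _ zt] /mapP[u _ zu]]].
suff -> : x = y by [].
apply/ffunP => j; have [->|j0] := eqVneq j ord0.
  apply: val_inj; move: Hx Hy; rewrite !inE => /eqP x0 /eqP y0.
  exact: etrans x0 (esym y0).
by rewrite -(set_coord_out x t j0) -zt zu set_coord_out.
Qed.

Theorem theorem6 (r : nat) (d : 'I_r.+1 -> nat)
    (d_gt0 : forall i, 0 < d i)
    (d1_large : (\sum_(i < r) (d (lift ord0 i) - 1))
                  * (\prod_(i < r) d (lift ord0 i)) <= d ord0) :
  ip_p (grid d) = ip_c (grid d) /\
  ip_c (grid d) = \prod_(i < r) d (lift ord0 i).
Proof.
have d0 := d_gt0 ord0; have up := ip_p_grid_le d0.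
have lo : \prod_(i < r) d (lift ord0 i) <= ip_c (grid d).
  have [P cP <-] := ip_c_attained (grid d).
  have := isometric_path_cover_card (@grid_isometric_path_size _ d) cP.
  rewrite [leqLHS]card_dffun_ord big_ord_recl [in leqRHS]big_ord_recl card_ord.
  under eq_bigr => i _ do rewrite card_ord.
  move: d1_large; set S := \sum_(i < r) _; set N := \prod_(i < r) _.
  (* With [D = d ord0], [#|P| < N] would give [D * N <= (N - 1) * (D + S)], that is
     [D + S <= S * N <= D]. Hence [S = 0], and then [D * N <= (N - 1) * D] contradicts [0 < D]. *)
  by move=> SN le_card; rewrite leqNgt; apply/negP => lt_PN; nia.
have cp := ip_c_le_ip_p (grid d); lia.
Qed.
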